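(* Let $\{Y, Y_n;\ n \geq 1\}$ be a sequence of i.i.d. nonnegative random variables such that $\mathbb{E}Y = \nu < \infty$. Then, for any given $\epsilon > 0$ and $q \geq 1$, $$\mathbb{P}\left( \frac{\sum_{k=1}^{n} Y_k}{n} > \nu - \epsilon \right) = 1 - o\left( n^{-q} \right) \quad \text{as } n \to \infty.$$
   Context: The notation $1 - o(n^{-q})$ means that $n^{q}\left(1 - \mathbb{P}(\cdot)\right) \to 0$ as $n\to\infty$. *)

(* Defs.v *)
From HB Require Import structures.
From mathcomp Require Import all_boot all_order all_algebra finmap.
From mathcomp Require Import all_classical all_reals all_analysis.

Set Implicit Arguments.
Unset Strict Implicit.
Unset Printing Implicit Defensive.

Import Order.TTheory GRing.Theory Num.Theory.
Import numFieldNormedType.Exports.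

Local Open Scope classical_set_scope.
Local Open Scope ring_scope.

(* Mutual independence: the product rule over every finite subfamily. *)
Definition mutually_independent (d d' : measure_display)
    (T : measurableType d) (T' : measurableType d') (R : realType)
    (P : probability T R) (I : choiceType) (X : I -> {RV P >-> T'}) : Prop :=
  forall (J : {fset I}) (B : I -> set T'),
    (forall i, i \in J -> measurable (B i)) ->
    P (\bigcap_(i in [set` J]) (X i @^-1` B i)) =
      (\prod_(i <- J) P (X i @^-1` B i))%E.

(* The laws are compared on measurable sets only: [distribution P X] is a
   function on all of [set T'], whose values off the sigma-algebra carry no
   meaning. *)
Definition same_law (d d' : measure_display)
    (T : measurableType d) (T' : measurableType d') (R : realType)
    (P : probability T R) (X Y : {RV P >-> T'}) : Prop :=
  forall B : set T', measurable B -> distribution P X B = distribution P Y B.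

(* p_n = 1 - o(n^(-q)) as n -> oo *)
Definition one_minus_o_pow (R : realType) (p : nat -> R) (q : R) : Prop :=
  (n%:R `^ q * (1 - p n)) @[n --> \oo] --> (0 : R).

(* Main.v *)
(* Chernoff's method. A simple function h below the identity on [0, +oo) can be
   chosen with E h(Y) > nu - eps. As h(Y) is bounded, some t > 0 makes
   E exp (t (nu - eps - h(Y))) at most e^-s with s > 0; independence then bounds
   the probability of the complement by e^(-s n), which beats every power of n.
   Because h takes finitely many values, expectations of products of independent
   variables are only needed as finite sums over value vectors. *)
Require Import Defs.
From HB Require Import structures.
From mathcomp Require Import all_boot all_order all_algebra finmap.
From mathcomp Require Import all_classical all_reals all_analysis.
From mathcomp Require Import measurable_realfun ring lra.

Set Implicit Arguments.
Unset Strict Implicit.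
Unset Printing Implicit Defensive.

Import Order.TTheory GRing.Theory Num.Theory.
Import numFieldNormedType.Exports.
Import HBNNSimple.

Local Open Scope classical_set_scope.
Local Open Scope ring_scope.

(** From [1 - x <= exp (-x)] one gets [exp x <= 1 / (1 - x)], and [(1 - x) (1 + x + 2 x^2) = 1 + x^2
    (1 - 2 x)] is at least 1 here. *)
Lemma expR_le_quadratic (R : realType) (x : R) :
  x <= 1 / 2 -> expR x <= 1 + x + 2 * x ^+ 2.
Proof.
move=> x_le; have x1 : 0 < 1 - x by lra.
have e1 : 1 - x <= (expR x)^-1 by rewrite -expRN; exact: expR_ge1Dx.
have e2 : expR x <= (1 - x)^-1.
  by rewrite -[expR x]invrK lef_pV2// posrE invr_gt0 expR_gt0.
apply: (le_trans e2); rewrite -[X in X <= _]mul1r ler_pdivrMr//.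
have : 0 <= x ^+ 2 * (1 - 2 * x) by rewrite mulr_ge0 ?sqr_ge0//; lra.
lra.
Qed.

(** To second order the exponential moment is at most [1 - t delta + 2 t^2 B^2], with [delta] the
    gap in the hypothesis and [B] a bound on [|c - a v|]. For small [t] the linear term wins. *)
Lemma exp_moment_lt1 (R : realType) (V : finType) (p a : V -> R) (c : R) :
  (forall v, 0 <= p v) -> \sum_v p v = 1 -> c < \sum_v a v * p v ->
  exists t s : R, [/\ 0 <= t, 0 < s &
    \sum_v expR (t * (c - a v)) * p v <= expR (- s)].
Proof.
move=> p_ge0 p1 c_lt.
pose delta := \sum_v a v * p v - c.
pose B : R := 1 + \sum_v `|c - a v|.
have delta_gt0 : 0 < delta by rewrite subr_gt0.
have B_ge v : `|c - a v| <= B.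
  rewrite /B (bigD1 v)//= addrCA lerDl addr_ge0// sumr_ge0//.
have B_gt0 : 0 < B by rewrite ltr_pwDl// sumr_ge0.
pose M := delta + B.
have M_gt0 : 0 < M by rewrite addr_gt0.
(* Chosen so that [t M^2 = delta / 4]. Since [M >= delta], [t B <= t M <= 1/4], so the quadratic
   bound applies; since [M >= B], the error [2 t^2 B^2] is at most [t delta / 2], which leaves
   [1 - s]. *)
pose t := delta / (4 * M ^+ 2).
have t_gt0 : 0 < t by rewrite divr_gt0// mulr_gt0// exprn_gt0.
have tM : t * M ^+ 2 = delta / 4 by rewrite /t; field; rewrite gt_eqF.
have tB : t * B <= 1 / 2.
  have : t * M * M <= 1 / 4 * M by rewrite -mulrA -expr2 tM /M; lra.
  rewrite ler_pM2r// => tM4.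
  have : t * B <= t * M by rewrite ler_wpM2l// /M ?ltW//; lra.
  lra.
have tBB : t * B ^+ 2 <= delta / 4.
  rewrite -tM; apply: ler_wpM2l; first exact: ltW.
  by rewrite lerXn2r ?nnegrE ?(ltW B_gt0) ?(ltW M_gt0)// /M; lra.
exists t, (t * delta / 2); split; [exact: ltW| |].
  by have := mulr_gt0 t_gt0 delta_gt0; lra.
apply: le_trans (expR_ge1Dx _).
have term v : expR (t * (c - a v)) * p v <=
    (1 + t * c + 2 * t ^+ 2 * B ^+ 2) * p v - t * (a v * p v).
  have x_le : t * (c - a v) <= 1 / 2.
    apply: (le_trans _ tB); apply: ler_wpM2l; first exact: ltW.
    exact: le_trans (ler_norm _) (B_ge v).
  have sq : (c - a v) ^+ 2 <= B ^+ 2.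
    by rewrite -(real_normK (num_real (c - a v))) lerXn2r ?nnegrE ?(ltW B_gt0).
  have : expR (t * (c - a v)) * p v <=
      (1 + t * (c - a v) + 2 * (t ^+ 2 * B ^+ 2)) * p v.
    apply: ler_wpM2r => //; apply: le_trans (expR_le_quadratic x_le) _.
    rewrite lerD2l exprMn; apply: ler_wpM2l => //.
    by apply: ler_wpM2l => //; exact: sqr_ge0.
  lra.
apply: le_trans (ler_sum _ (fun v _ => term v)) _.
rewrite sumrB -mulr_sumr p1 -mulr_sumr.
have -> : \sum_v a v * p v = delta + c by rewrite /delta; ring.
have : t * (t * B ^+ 2) <= t * (delta / 4) by rewrite ler_wpM2l// ltW.
lra.
Qed.

Lemma mutually_independent_ord (d d' : measure_display)
    (T : measurableType d) (T' : measurableType d') (R : realType)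
    (P : probability T R) (X : nat -> {RV P >-> T'})
    (n : nat) (B : 'I_n -> set T') :
  mutually_independent X -> (forall i, measurable (B i)) ->
  P [set w | forall i : 'I_n, B i (X i w)] =
    (\prod_(i < n) P (X i @^-1` B i))%E.
Proof.
move=> indepX mB.
(* Independence speaks of families indexed by all of [nat], so [B] is extended by the full set. *)
pose C (k : nat) := if insub k is Some i then B i else setT.
have CE (i : 'I_n) : C i = B i by rewrite /C valK.
pose J : {fset nat} := [fset k in iota 0 n]%fset.
have JE k : (k \in J) = (k < n)%N by rewrite !inE/= mem_iota.
have mC k : k \in J -> measurable (C k).
  by rewrite JE => kn; rewrite -[k]/(val (Ordinal kn)) CE.
have := indepX J C mC.
rewrite (_ : \bigcap_(i in _) _ = [set w | forall i : 'I_n, B i (X i w)]).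
  move=> ->; rewrite (perm_big (iota 0 n)); last first.
    apply: uniq_perm; [exact: fset_uniq|exact: iota_uniq|].
    by move=> k; rewrite JE mem_iota.
  rewrite -[n in iota 0 n]subn0 big_mkord.
  by apply: eq_bigr => i _; rewrite CE.
apply/seteqP; split => w /=.
  by move=> Cw i; rewrite -CE; apply: Cw; rewrite /= JE.
move=> Bw k /=; rewrite JE => kn.
by rewrite -[k]/(val (Ordinal kn)) CE; exact: Bw.
Qed.

(* The event is covered by the boxes [h (X_k) = f k for all k < n] with
   [\sum_k f k <= n c]; each contributes at most its probability times
   [exp (t (n c - \sum_k f k))], and these products sum to an n-th power. *)
Lemma chernoff_simple (d d' : measure_display)
    (T : measurableType d) (T' : measurableType d') (R : realType)
    (P : probability T R) (X : nat -> {RV P >-> T'})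
    (h : {nnsfun T' >-> R}) (p : R -> R) (t c : R) (n : nat) (A : set T) :
  mutually_independent X ->
  (forall k v, P (X k @^-1` (h @^-1` [set v])) = (p v)%:E) ->
  0 <= t -> measurable A ->
  A `<=` [set w | \sum_(k < n) h (X k w) <= n%:R * c] ->
  (P A <= ((\sum_(v : fset_set (range h))
              expR (t * (c - val v)) * p (val v)) ^+ n)%:E)%E.
Proof.
move=> indepX pE t_ge0 mA Asub.
have fin_h : finite_set (range h) by exact: fimfunP.
pose V : finType := fset_set (range h).
have p_ge0 v : 0 <= p v by rewrite -lee_fin -(pE 0%N).
pose E (f : {ffun 'I_n -> V}) :=
  [set w | forall k : 'I_n, (h @^-1` [set val (f k)]) (X k w)].
have mh v : measurable (h @^-1` [set v]) by exact: measurable_sfunP.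
have mE f : measurable (E f).
  rewrite (_ : E f = \bigcap_(k : 'I_n) X k @^-1` (h @^-1` [set val (f k)])).
    apply: fin_bigcap_measurable => // k _.
    by rewrite -[X in measurable X]setTI; exact: measurable_funP.
  by apply/seteqP; split => w /= Ew k; [move=> _; exact: Ew|exact: Ew].
have PE f : P (E f) = (\prod_(k < n) p (val (f k)))%:E.
  rewrite (mutually_independent_ord indepX (fun k => mh (val (f k)))).
  under eq_bigr do rewrite pE.
  by rewrite prodEFin.
pose bad (f : {ffun 'I_n -> V}) := \sum_(k < n) val (f k) <= n%:R * c.
have cover : A `<=` \bigcup_(f in [set f | bad f]) E f.
  move=> w /Asub /= sum_le.
  have inV k : h (X k w) \in fset_set (range h).
    by rewrite in_fset_set// inE; exists (X k w).
  exists [ffun k : 'I_n => [` inV k]%fset] => [|k]; last by rewrite /= ffunE.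
  by rewrite /bad/=; under eq_bigr do rewrite ffunE.
have fin_bad : finite_set [set f | bad f] by exact: finite_finset.
apply: le_trans (content_sub_fsum P fin_bad (fun f _ => mE f) mA cover) _.
rewrite (_ : \sum_(_ \in _) _ = \sum_(f | bad f) P (E f)); last first.
  apply/esym/bigfs; first exact: index_enum_uniq.
  by move=> f _; rewrite mem_index_enum.
under eq_bigr do rewrite PE.
rewrite sumEFin lee_fin.
(* Distributivity: the n-th power expands into a sum over all value vectors, bad or not. *)
have -> : (\sum_(v : V) expR (t * (c - val v)) * p (val v)) ^+ n =
    \sum_(f : {ffun 'I_n -> V})
      \prod_(k < n) (expR (t * (c - val (f k))) * p (val (f k))).
  rewrite -(bigA_distr_bigA (fun _ v => expR (t * (c - val v)) * p (val v))).
  by rewrite prodr_const card_ord.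
have prod_ge0 (f : {ffun 'I_n -> V}) : 0 <= \prod_(k < n) p (val (f k)).
  by apply: prodr_ge0.
(* Termwise comparison: a vector that is not bad contributes a nonnegative term on the right, and
   for a bad one the exponent [t (n c - \sum_k f k)] is nonnegative. *)
rewrite big_mkcond; apply: ler_sum => /= f _.
rewrite big_split/= -expR_sum.
case: ifP => [bad_f|_]; last by apply: mulr_ge0; rewrite ?expR_ge0 ?prod_ge0.
apply: ler_peMl; first exact: prod_ge0.
apply: le_trans (expR_ge1Dx _); rewrite lerDl -mulr_sumr mulr_ge0//.
by rewrite sumrB sumr_const card_ord -mulr_natl subr_ge0.
Qed.

(** Multiply [ln x <= a x - ln a] by [q]. With [a = b / (q + 1)] one has [q a <= b], and [a] stays
    meaningful at [q = 0]; the constant is [a^(-q)]. *)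
Lemma powR_le_expR (R : realType) (q b : R) : 0 <= q -> 0 < b ->
  exists C : R, forall x : R, 0 < x -> x `^ q <= C * expR (b * x).
Proof.
move=> q_ge0 b_gt0; pose a := b / (q + 1).
have a_gt0 : 0 < a by rewrite divr_gt0//; lra.
exists (expR (- (q * ln a))) => x x_gt0.
rewrite /powR gt_eqF// -expRD ler_expR.
have ax_gt0 : 0 < a * x by exact: mulr_gt0.
have ln_le : ln x <= a * x - ln a.
  have : ln (a * x) <= a * x - 1.
    have := @le_ln1Dx R (a * x - 1); rewrite addrCA subrr addr0; apply; lra.
  rewrite lnM ?posrE//; lra.
have qa : q * a <= b.
  by rewrite /a mulrCA ger_pMr// ler_pdivrMr; lra.
have : q * a * x <= b * x by rewrite ler_wpM2r// ltW.
have : q * ln x <= q * (a * x - ln a) by rewrite ler_wpM2l.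
lra.
Qed.

(** Half of the decay rate absorbs the power; the other half leaves a geometric sequence of ratio
    [e^(-s/2)]. *)
Lemma powR_expRN_cvg0 (R : realType) (q s : R) : 0 <= q -> 0 < s ->
  (n%:R `^ q * expR (- s) ^+ n) @[n --> \oo] --> (0 : R).
Proof.
move=> q_ge0 s_gt0.
have s2_gt0 : 0 < s / 2 by lra.
have [C powR_le] := powR_le_expR q_ge0 s2_gt0.
apply: (@squeeze_cvgr _ _ _ _ (cst 0) (geometric C (expR (- (s / 2))))).
- near=> n; have n_gt0 : 0 < n%:R :> R by rewrite ltr0n; near: n; exists 1%N.
  rewrite /= mulr_ge0 ?powR_ge0 ?exprn_ge0 ?expR_ge0//=.
  have -> : expR (- (s / 2)) ^+ n = expR (s / 2 * n%:R) * expR (- s) ^+ n.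
    by rewrite -!expRM_natr -expRD; congr expR; field.
  by rewrite mulrA ler_wpM2r ?exprn_ge0 ?expR_ge0// powR_le.
- exact: cvg_cst.
- apply: cvg_geometric; rewrite ger0_norm ?expR_ge0// expR_lt1; lra.
Unshelve. all: by end_near. Qed.

Lemma sum_preimage_nnsfun (d : measure_display) (T : measurableType d)
    (R : realType) (P : probability T R) (h : {nnsfun T >-> R}) :
  \sum_(v : fset_set (range h)) fine (P (h @^-1` [set val v])) = 1.
Proof.
have fin_h : finite_set (range h) by exact: fimfunP.
have cover : \bigcup_(v in range h) h @^-1` [set v] = setT.
  by apply/seteqP; split => // x _; exists (h x) => //; exists x.
apply: EFin_inj; rewrite -sumEFin -(@probability_setT _ _ _ P) -[in RHS]cover.
rewrite measure_fin_bigcup//.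
- rewrite fsbig_finite// big_seq_fsetE; apply: eq_bigr => v _.
  by rewrite fineK// fin_num_measure.
- apply/trivIsetP => u v _ _ /eqP uv; apply/seteqP; split => // x.
  by move=> [/= -> /uv].
Qed.

Lemma sintegral_fset (d : measure_display) (T : measurableType d)
    (R : realType) (P : probability T R) (h : {nnsfun T >-> R}) :
  sintegral P h =
    (\sum_(v : fset_set (range h)) val v * fine (P (h @^-1` [set val v])))%:E.
Proof.
rewrite sintegralE fsbig_finite; last exact: fimfunP.
rewrite -sumEFin big_seq_fsetE; apply: eq_bigr => v _.
by rewrite EFinM fineK// fin_num_measure.
Qed.

(** The integral of a nonnegative function is a supremum over simple functions below it. Integrating
    [|y|] against the law of [Y] makes the integrand nonnegative on the whole line, and [h] a
    function of the value, so that one [h] serves every [Yn k]. *)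
Lemma exists_nnsfun_expectation (d : measure_display) (T : measurableType d)
    (R : realType) (P : probability T R) (Y : {RV P >-> R}) (c : R) :
  (forall w, 0 <= Y w) -> (c%:E < 'E_P[Y])%E ->
  exists h : {nnsfun R >-> R},
    (forall y, h y <= `|y|) /\ (c%:E < sintegral (distribution P Y) h)%E.
Proof.
move=> Y_ge0.
have -> : ('E_P[Y] = \int[distribution P Y]_y `|y|%:E)%E.
  rewrite ge0_integral_distribution//; last first.
    by apply/measurable_EFinP; exact: normr_measurable.
  by rewrite expectation_def; apply: eq_integral => w _ /=; rewrite ger0_norm.
rewrite ge0_integralTE// => /ereal_sup_gt[_ [h h_le <-] c_lt].
by exists h; split => // y; rewrite -lee_fin h_le.
Qed.

(* [Yn k] is the informal Y_{k+1}, so the sum over k < n is Y_1 + ... + Y_n. *)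
Theorem lemma2p1 (R : realType) (d : measure_display) (T : measurableType d)
    (P : probability T R) (Y : {RV P >-> R}) (Yn : nat -> {RV P >-> R})
    (nu : R)
    (Y_ge0 : forall w, 0 <= Y w)
    (Yn_ge0 : forall k w, 0 <= Yn k w)
    (Yn_indep : mutually_independent Yn)
    (Yn_law : forall k, same_law (Yn k) Y)
    (EY : ('E_P[Y] = nu%:E)%E)
    (eps : R) (eps_gt0 : 0 < eps) (q : R) (q_ge1 : 1 <= q) :
  one_minus_o_pow
    (fun n => fine (P [set w | (\sum_(k < n) Yn k w) / n%:R > nu - eps])) q.
Proof.
have c_lt : ((nu - eps)%:E < 'E_P[Y])%E by rewrite EY lte_fin; lra.
have [h [h_le]] := exists_nnsfun_expectation Y_ge0 c_lt.
rewrite sintegral_fset lte_fin.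
set p := fun v : R => fine (distribution P Y (h @^-1` [set v])).
move=> /(exp_moment_lt1 (p := fun v : fset_set (range h) => p (val v))).
case=> [v||t [s [t_ge0 s_gt0 moment_le]]].
- exact: fine_ge0.
- exact: sum_preimage_nnsfun.
have pE k v : P (Yn k @^-1` (h @^-1` [set v])) = (p v)%:E.
  by rewrite /p fineK ?fin_num_measure//; apply: Yn_law.
apply: (@squeeze_cvgr _ _ _ _ (cst 0) (fun n => n%:R `^ q * expR (- s) ^+ n)).
(* Positivity of [n] lets the average be compared with [nu - eps] by clearing the denominator. *)
- near=> n; have n_gt0 : 0 < n%:R :> R by rewrite ltr0n; near: n; exists 1%N.
  set A := [set w | _].
  have mA : measurable A.
    rewrite (_ : A = (fun w => (\sum_(k < n) Yn k w) / n%:R) @^-1`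
        [set` `]nu - eps, +oo[]); last first.
      by apply/seteqP; split => w; rewrite /A /= in_itv/= andbT.
    rewrite -[X in measurable X]setTI.
    apply: measurable_funM => //; apply: measurable_sum => k.
    exact: measurable_funP.
  have PA : 1 - fine (P A) = fine (P (~` A)).
    by rewrite probability_setC// fineB// fin_num_measure.
  rewrite PA mulr_ge0 ?powR_ge0 ?fine_ge0//=.
  apply: ler_wpM2l; first exact: powR_ge0.
  have := @chernoff_simple _ _ _ _ _ P Yn h p t (nu - eps) n (~` A) Yn_indep pE
    t_ge0 (measurableC mA).
  have sub : ~` A `<=` [set w | \sum_(k < n) h (Yn k w) <= n%:R * (nu - eps)].
    move=> w /negP; rewrite -leNgt ler_pdivrMr// mulrC => /(le_trans _); apply.
    by apply: ler_sum => k _; rewrite (le_trans (h_le _))// ger0_norm.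
  move=> /(_ sub); rewrite -[P _]fineK ?fin_num_measure ?lee_fin//;
    last exact: measurableC.
  move=> /le_trans; apply; apply: lerXn2r => //.
    by rewrite nnegrE sumr_ge0// => v _; rewrite mulr_ge0 ?expR_ge0 ?fine_ge0.
  by rewrite nnegrE expR_ge0.
- exact: cvg_cst.
- by apply: powR_expRN_cvg0 => //; lra.
Unshelve. all: by end_near. Qed.
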